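(* Let $G=(V,E)$ be a graph and let $\tilde G=(\tilde V,\tilde E)$ be obtained by splitting an edge of $G$, that is, by replacing an edge $\{x,y\}\in E$ by a path $x\sim z\sim y$ of length $2$ through a new vertex $z$. Then $$\nu(\tilde G)\le\nu(G).$$ More generally, if $\tilde G$ is a subdivision of $G$, then $$\nu(\tilde G)\le\nu(G).$$
   Context: All graphs $G=(V,E)$ are finite and simple; $x\sim y$ denotes adjacency. $E^{or}(G)$ is the set of ordered pairs $(x,y)$ with $x\sim y$. A magnetic potential is a map $\sigma:E^{or}(G)\to S^1=\{z\in\mathbb{C}:|z|=1\}$ with $\sigma(y,x)=\sigma(x,y)^{-1}$. The magnetic Laplacian on functions $f:V\to\mathbb{C}$ is $\Delta^\sigma f(x)=\sum_{y\sim x}(f(x)-\sigma(x,y)f(y))$, and $\lambda_1^\sigma(G)$ is its smallest eigenvalue. The magneto-spectral height is $\nu(G)=\sup_\sigma\lambda_1^\sigma(G)$, over all magnetic potentials on $G$. A subdivision of $G$ is a graph obtained from $G$ by finitely many successive edge splittings. *)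

(* Defs.v *)
From HB Require Import structures.
From mathcomp Require Import all_boot all_order all_algebra.
From mathcomp Require Import complex.
From mathcomp Require Import boolp classical_sets reals.

Set Implicit Arguments.
Unset Strict Implicit.
Unset Printing Implicit Defensive.

Import GRing.Theory Num.Theory.

Local Open Scope ring_scope.
Local Open Scope complex_scope.
Local Open Scope classical_set_scope.

Record sgraph := SGraph {
  vertex :> finType;
  adj : rel vertex;
  adj_sym : symmetric adj;
  adj_irrefl : irreflexive adj }.

Definition graph_iso (G H : sgraph) : Prop :=
  exists2 phi : G -> H, bijective phi &
    forall x y : G, adj (phi x) (phi y) = adj x y.

(* Vertices of the split graph: [Some u] for the old vertices, [None] for the
   new one. *)
Definition split_adj (G : sgraph) (x y : G) : rel (option G) :=
  fun a b => match a, b with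
  | Some u, Some v =>
      adj u v && ~~ ((u == x) && (v == y) || (u == y) && (v == x))
  | Some u, None | None, Some u => (u == x) || (u == y)
  | None, None => false
  end.

Fact split_adj_sym (G : sgraph) (x y : G) : symmetric (split_adj x y).
Proof.
move=> [u|] [v|] //=; rewrite adj_sym; congr (_ && ~~ _).
by rewrite orbC [(u == y) && _]andbC [(u == x) && _]andbC.
Qed.

Fact split_adj_irrefl (G : sgraph) (x y : G) : irreflexive (split_adj x y).
Proof. by move=> [u|] //=; rewrite adj_irrefl. Qed.

Definition split_graph (G : sgraph) (x y : G) : sgraph :=
  SGraph (@split_adj_sym G x y) (@split_adj_irrefl G x y).

Definition edge_splitting (G H : sgraph) : Prop :=
  exists x y : G, adj x y /\ graph_iso (split_graph x y) H.

Inductive subdivision (G : sgraph) : sgraph -> Prop :=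
| subdivision_iso H : graph_iso G H -> subdivision G H
| subdivision_split H K :
    subdivision G H -> edge_splitting H K -> subdivision G K.

(* A potential is represented by a function on all pairs of vertices; only its
   values on adjacent pairs are constrained, and only those are ever used. *)
Definition magnetic_potential (R : realType) (G : sgraph)
    (sigma : G -> G -> R[i]) : Prop :=
  forall x y : G, adj x y ->
    `|sigma x y| = 1 /\ sigma y x = (sigma x y)^-1.

(* [R[i]^o] is [R[i]] seen as a vector space over itself. *)
Definition magnetic_laplacian (R : realType) (G : sgraph)
    (sigma : G -> G -> R[i]) (f : {ffun G -> R[i]^o}) : {ffun G -> R[i]^o} :=
  [ffun x => \sum_(y | adj x y) (f x - sigma x y * f y)].

Fact magnetic_laplacian_is_linear (R : realType) (G : sgraph)
    (sigma : G -> G -> R[i]) : linear (magnetic_laplacian sigma).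
Proof.
move=> a f g; apply/ffunP => x; rewrite !ffunE scaler_sumr -big_split /=.
apply: eq_bigr => y _; rewrite !ffunE /GRing.scale /=.
by rewrite mulrDr mulrBr opprD addrACA mulrCA.
Qed.

HB.instance Definition _ (R : realType) (G : sgraph) (sigma : G -> G -> R[i]) :=
  GRing.isLinear.Build R[i] {ffun G -> R[i]^o} {ffun G -> R[i]^o} *:%R
    (magnetic_laplacian sigma) (magnetic_laplacian_is_linear sigma).

Definition magnetic_eigenvalue (R : realType) (G : sgraph)
    (sigma : G -> G -> R[i]) (l : R[i]) : bool :=
  passmx.leigenvalue (linfun (magnetic_laplacian sigma)) l.

Lemma magnetic_eigenvalueP (R : realType) (G : sgraph)
    (sigma : G -> G -> R[i]) (l : R[i]) :
  reflect (exists2 f : {ffun G -> R[i]^o},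
             f != 0 & magnetic_laplacian sigma f = l *: f)
          (magnetic_eigenvalue sigma l).
Proof.
have kerE f : (f \in passmx.leigenspace (linfun (magnetic_laplacian sigma)) l) =
    (magnetic_laplacian sigma f == l *: f).
  by rewrite memv_ker add_lfunE opp_lfunE scale_lfunE id_lfunE lfunE subr_eq0.
apply: (iffP idP) => [nz|[f nzf /eqP Df]].
  exists (vpick (passmx.leigenspace (linfun (magnetic_laplacian sigma)) l)).
    by rewrite vpick0.
  by apply/eqP; rewrite -kerE memv_pick.
apply: contraNneq nzf => E0.
by rewrite -memv0 -E0 kerE Df.
Qed.

(* When [sigma] is a magnetic potential and [G] has a vertex, the Laplacian is
   Hermitian for the standard inner product: its spectrum is a finite nonempty
   set of reals, and [inf] is its minimum. *)
Definition lambda1 (R : realType) (G : sgraph) (sigma : G -> G -> R[i]) : R :=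
  inf [set l : R | magnetic_eigenvalue sigma l%:C].

(* The set is nonempty (take [sigma] constant equal to 1) and bounded above (by
   the minimum degree of [G], using Rayleigh quotients of indicators of
   vertices), so [sup] is its least upper bound. If [G] has no vertex,
   [lambda1] and [nu] are both [0] by convention. *)
Definition nu (R : realType) (G : sgraph) : R :=
  sup [set l : R | exists2 sigma : G -> G -> R[i],
                     magnetic_potential sigma & l = lambda1 sigma].

(* Main.v *)
Require Import Defs.
From mathcomp Require Import all_boot all_order all_algebra.
From mathcomp Require Import complex sesquilinear spectral ring.
From mathcomp Require Import boolp classical_sets reals.

(** The smallest eigenvalue of the magnetic Laplacian is the minimum of the
    Rayleigh quotient [energy sigma f / (2 * mass f)], where [mass f] is the sum
    of the [|f x|^2] and [energy sigma f] is the sum of the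
    [|f x - sigma x y * f y|^2] over ordered adjacent pairs
    ([lambda1_attained]). This rests on the spectral theorem for Hermitian
    matrices and on summation by parts ([laplacian_energy]).

    Let [z] be the vertex that splits the edge [xy], and let [sigma] be a
    potential on the split graph. Give the edge [xy] of [G] the transport of
    [sigma] along the path from [x] to [y] through [z]: this is
    [contracted_potential sigma]. A function [f] on [G] extends to [z] by
    transporting its value at [x] along the edge [xz]. The edge [xz] then
    carries no energy, and the edge [zy] carries exactly the energy that [xy]
    had in [G]. The extension thus has the same energy as [f]
    ([energy_split_extension]) and at least its mass
    ([mass_split_extension]). Since energies are nonnegative, its Rayleigh
    quotient is at most that of [f]; taking for [f] a ground state on [G] gives
    [lambda1 sigma <= lambda1 (contracted_potential sigma) <= nu R G]. The last
    inequality uses that [lambda1] is bounded on potentials of [G]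
    ([lambda1_le_card]), so that the supremum is an upper bound.

    An edge splitting is only given up to isomorphism, hence the invariance
    [nu_iso]; subdivisions then follow by induction. *)

Set Implicit Arguments.
Unset Strict Implicit.
Unset Printing Implicit Defensive.

Import GRing.Theory Num.Theory Num.Def Order.TTheory.

Local Open Scope ring_scope.

(** * Rayleigh quotients of Hermitian operators *)

(** In an orthonormal basis of eigenvectors the form [u A u^t*] is a sum of
    squares weighted by the eigenvalues, hence at least the smallest eigenvalue
    times the norm. The eigenvalues being real, they have a minimum. *)
Lemma hermsymmx_min_eigenvalue (R : rcfType) (n : nat) (A : 'M[R[i]]_n) :
  (0 < n)%N -> A \is hermsymmx ->
  exists (l : R) (v : 'rV[R[i]]_n),
    [/\ v != 0, v *m A = l%:C%C *: v &
        forall u : 'rV_n,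
          l%:C%C * (u *m (u ^t*)%sesqui) 0 0
            <= (u *m A *m (u ^t*)%sesqui) 0 0].
Proof.
case: n A => // n A _ Aherm.
have /hermitian_normalmx /orthomx_spectralP := Aherm.
have := hermitian_spectral_diag_real Aherm; have := spectral_unitarymx A.
set P := spectralmx A; set d := spectral_diag A => PU dreal.
rewrite (invmx_unitary PU) => Adec.
have PPt : P *m (P ^t*)%sesqui = 1%:M by apply/unitarymxP.
have PtP : (P ^t*)%sesqui *m P = 1%:M by exact: mulmx1C.
have dE i : d 0 i = (complex.Re (d 0 i))%:C%C.
  by rewrite RRe_real ?(mxOverP dreal).
case: (arg_minP (fun i => complex.Re (d 0 i)) (isT : xpredT (ord0 : 'I_n.+1))).
move=> i _ imin; exists (complex.Re (d 0 i)), (row i P); split.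
- apply: contraPneq PPt => Pi0 /(congr1 (row i)).
  rewrite row_mul Pi0 mul0mx row1 => /rowP/(_ i).
  by rewrite [LHS]mxE [RHS]mxE !eqxx => /esym/eqP; rewrite oner_eq0.
- rewrite -dE Adec rowE -!mulmxA (mulmxA P) PPt mul1mx.
  rewrite mulmxA -!rowE; apply/rowP => j; rewrite !mxE.
  rewrite (bigD1 i)//= big1 ?addr0 ?mxE ?eqxx ?mulr1n//.
  by move=> k ki; rewrite !mxE eq_sym (negPf ki) mulr0n mul0r.
move=> u; set w := u *m (P ^t*)%sesqui.
have wt : (w ^t*)%sesqui = P *m (u ^t*)%sesqui.
  by rewrite trmx_mul map_mxM /= trmxCK.
have -> : u *m A *m (u ^t*)%sesqui = w *m diag_mx d *m (w ^t*)%sesqui.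
  by rewrite wt Adec !mulmxA.
have -> : u *m (u ^t*)%sesqui = w *m (w ^t*)%sesqui.
  by rewrite wt mulmxA -[w *m P]mulmxA PtP mulmx1.
rewrite [in leLHS]mxE [in leRHS]mxE mulr_sumr; apply: ler_sum => j _.
rewrite mul_mx_diag [in leRHS]mxE ![(w ^t*)%sesqui _ _]mxE ![w^T _ _]mxE.
rewrite [w 0 j * d 0 j]mulrC -mulrA -normCK.
by apply: ler_wpM2r; rewrite ?exprn_ge0// [leRHS]dE lecR imin.
Qed.

(** The matrix statement for an operator given by a kernel on an arbitrary
    finite type. Matrices act on row vectors, hence the transposed indices in
    [A]. *)
Lemma hermitian_kernel_min_eigenvalue (R : rcfType) (I : finType)
    (k : I -> I -> R[i]) :
  (0 < #|I|)%N -> (forall x y, k y x = (k x y)^*) ->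
  exists (l : R) (f : {ffun I -> R[i]^o}),
    [/\ f != 0, forall x, \sum_y k x y * f y = l%:C%C * f x &
        forall g : {ffun I -> R[i]^o},
          l%:C%C * (\sum_x `|g x| ^+ 2)
            <= \sum_x (\sum_y k x y * g y) * (g x)^*].
Proof.
move=> I0 kherm.
have sumE (F : I -> R[i]) : \sum_x F x = \sum_(i < #|I|) F (enum_val i).
  by rewrite (reindex _ (onW_bij _ (enum_val_bij I))).
pose A : 'M[R[i]]_#|I| := \matrix_(i, j) k (enum_val j) (enum_val i).
have Aherm : A \is hermsymmx.
  apply/is_hermitianmxP; rewrite expr0 scale1r; apply/matrixP => i j.
  by rewrite !mxE kherm.
have [l [v [v0 vA vmin]]] := hermsymmx_min_eigenvalue I0 Aherm.
exists l, [ffun x => v 0 (enum_rank x)]; split.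
- apply: contra_neq v0 => /ffunP f0; apply/rowP => i.
  by have := f0 (enum_val i); rewrite !ffunE enum_valK mxE.
- move=> x; rewrite ffunE; have /rowP/(_ (enum_rank x)) := vA.
  rewrite [RHS]mxE => <-; rewrite sumE [RHS]mxE; apply: eq_bigr => i _.
  by rewrite ffunE enum_valK mxE enum_rankK mulrC.
move=> g; have := vmin (\row_i g (enum_val i)).
set u := \row_i _; congr (_ * _ <= _).
  by rewrite sumE mxE; apply: eq_bigr => i _; rewrite !mxE normCK.
rewrite sumE mxE; apply: eq_bigr => i _; rewrite mxE [in RHS]sumE.
congr (_ * _); last by rewrite !mxE.
by apply: eq_bigr => j _; rewrite !mxE mulrC.
Qed.

(** * The magnetic Dirichlet energy *)

Definition mass (R : realType) (V : finType) (f : {ffun V -> R[i]^o}) : R[i] :=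
  \sum_x `|f x| ^+ 2.

(** Every edge is counted once in each direction: this is twice the Dirichlet
    energy, hence the factors [*+ 2] below. *)
Definition energy (R : realType) (G : sgraph) (sigma : G -> G -> R[i])
    (f : {ffun G -> R[i]^o}) : R[i] :=
  \sum_x \sum_(y | adj x y) `|f x - sigma x y * f y| ^+ 2.

Lemma mass_ge0 (R : realType) (V : finType) (f : {ffun V -> R[i]^o}) :
  0 <= mass f.
Proof. by apply: sumr_ge0 => x _; rewrite exprn_ge0. Qed.

Lemma mass_gt0 (R : realType) (V : finType) (f : {ffun V -> R[i]^o}) :
  f != 0 -> 0 < mass f.
Proof.
move=> f0; rewrite lt0r mass_ge0 andbT; apply: contra_neq f0 => m0.
apply/ffunP => x; rewrite ffunE; apply/eqP; rewrite -normr_eq0 -sqrf_eq0.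
apply/eqP; apply: psumr_eq0P m0 x isT => y _; exact: exprn_ge0.
Qed.

Lemma energy_ge0 (R : realType) (G : sgraph) (sigma : G -> G -> R[i])
    (f : {ffun G -> R[i]^o}) : 0 <= energy sigma f.
Proof.
by apply: sumr_ge0 => x _; apply: sumr_ge0 => y _; rewrite exprn_ge0.
Qed.

Lemma magnetic_potentialC (R : realType) (G : sgraph) (sigma : G -> G -> R[i])
    (x y : G) :
  magnetic_potential sigma -> adj x y -> sigma y x = (sigma x y)^*.
Proof.
move=> sp xy; have [n1 ->] := sp _ _ xy.
by rewrite invC_norm n1 expr1n invr1 mul1r.
Qed.

(** The two differences are related by the unit factor [sigma x y]. *)
Lemma edge_energyC (R : realType) (G : sgraph) (sigma : G -> G -> R[i])
    (f : {ffun G -> R[i]^o}) (x y : G) :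
  magnetic_potential sigma -> adj x y ->
  `|f y - sigma y x * f x| = `|f x - sigma x y * f y|.
Proof.
move=> sp xy; have [n1 ->] := sp _ _ xy.
have s0 : sigma x y != 0 by rewrite -normr_eq0 n1 oner_eq0.
rewrite -[LHS]mul1r -n1 -normrM mulrBr mulrA divff// mul1r.
by rewrite distrC.
Qed.

(** Summation by parts: for each edge, the terms of both orientations add up to
    the square of the difference along that edge. *)
Lemma laplacian_energy (R : realType) (G : sgraph) (sigma : G -> G -> R[i])
    (f : {ffun G -> R[i]^o}) :
  magnetic_potential sigma ->
  (\sum_x magnetic_laplacian sigma f x * (f x)^*) *+ 2 = energy sigma f.
Proof.
move=> sp; pose t x y : R[i] := (f x - sigma x y * f y) * (f x)^*.
have -> : \sum_x magnetic_laplacian sigma f x * (f x)^* =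
    \sum_x \sum_(y | adj x y) t x y.
  by apply: eq_bigr => x _; rewrite ffunE mulr_suml.
rewrite mulr2n.
(* Reverse all edges in one of the two copies of the sum. *)
have {2}-> : \sum_x \sum_(y | adj x y) t x y = \sum_x \sum_(y | adj x y) t y x.
  rewrite (exchange_big_dep predT)//=; apply: eq_bigr => x _.
  by apply: eq_bigl => y; rewrite adj_sym.
rewrite -big_split; apply: eq_bigr => x _; rewrite -big_split.
apply: eq_bigr => y xy /=; rewrite /t (magnetic_potentialC sp xy) normCK.
have [n1 _] := sp _ _ xy.
have nn : sigma x y * (sigma x y)^* = 1 by rewrite -normCK n1 expr1n.
rewrite rmorphB rmorphM /=.
set a := f x; set b := f y; set s := sigma x y in nn *.
have -> : (b - s^* * a) * b^* = (s * s^*) * (b * b^*) - a * (s^* * b^*).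
  by rewrite nn; ring.
by ring.
Qed.

(** * The bottom of the spectrum *)

Lemma laplacian_min_eigenvalue (R : realType) (G : sgraph)
    (sigma : G -> G -> R[i]) :
  (0 < #|G|)%N -> magnetic_potential sigma ->
  exists (l : R) (f : {ffun G -> R[i]^o}),
    [/\ f != 0, magnetic_laplacian sigma f = l%:C%C *: f &
        forall g, l%:C%C * mass g *+ 2 <= energy sigma g].
Proof.
move=> G0 sp; pose k (x y : G) : R[i] :=
  (#|adj x|)%:R *+ (x == y) - sigma x y *+ adj x y.
have kherm x y : k y x = (k x y)^*.
  rewrite /k rmorphB [y == x]eq_sym [adj y x]adj_sym !rmorphMn /=.
  have [->|xy] := eqVneq x y; first by rewrite adj_irrefl conjC1.
  case axy: (adj x y); last by rewrite !mulr0n.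
  by rewrite (magnetic_potentialC sp axy) !mulr0n.
have kE (g : {ffun G -> R[i]^o}) x :
    \sum_y k x y * g y = magnetic_laplacian sigma g x.
  rewrite ffunE sumrB sumr_const -mulr_natl.
  rewrite (eq_bigr _ (fun y _ => mulrBl (g y) _ _)) sumrB.
  congr (_ - _).
    rewrite (bigD1 x)//= eqxx big1 ?addr0// => y yx.
    by rewrite eq_sym (negPf yx) mul0r.
  by rewrite [RHS]big_mkcond; apply: eq_bigr => y _; case: adj; rewrite ?mul0r.
have [l [f [f0 fl lmin]]] := hermitian_kernel_min_eigenvalue G0 kherm.
exists l, f; split => //.
  by apply/ffunP => x; rewrite -kE fl ffunE.
move=> g; rewrite -laplacian_energy// lerMn2r /=.
by under [leRHS]eq_bigr => x _ do rewrite -kE; exact: lmin.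
Qed.

Lemma eigenvalue_energy (R : realType) (G : sgraph) (sigma : G -> G -> R[i])
    (l : R[i]) (f : {ffun G -> R[i]^o}) :
  magnetic_potential sigma -> magnetic_laplacian sigma f = l *: f ->
  energy sigma f = l * mass f *+ 2.
Proof.
move=> sp fl; rewrite -laplacian_energy// fl mulr_sumr; congr (_ *+ 2).
by apply: eq_bigr => x _; rewrite ffunE normCK mulrA.
Qed.

(** An eigenfunction [g] with eigenvalue [m] has energy [m * mass g *+ 2], and
    [laplacian_min_eigenvalue] bounds it below by [l * mass g *+ 2]; hence [l]
    is the infimum of the spectrum. *)
Lemma lambda1_attained (R : realType) (G : sgraph) (sigma : G -> G -> R[i]) :
  (0 < #|G|)%N -> magnetic_potential sigma ->
  exists f : {ffun G -> R[i]^o},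
    [/\ f != 0, energy sigma f = (lambda1 sigma)%:C%C * mass f *+ 2 &
        forall g, (lambda1 sigma)%:C%C * mass g *+ 2 <= energy sigma g].
Proof.
move=> G0 sp; have [l [f [f0 fl lmin]]] := laplacian_min_eigenvalue G0 sp.
suff -> : lambda1 sigma = l.
  by exists f; split => //; exact: eigenvalue_energy.
have l_eig : magnetic_eigenvalue sigma l%:C%C.
  by apply/magnetic_eigenvalueP; exists f.
have l_lb : lbound [set m : R | magnetic_eigenvalue sigma m%:C%C]%classic l.
  move=> m /magnetic_eigenvalueP[g g0 gm].
  have := lmin g; rewrite (eigenvalue_energy sp gm) lerMn2r /=.
  by rewrite ler_pM2r ?mass_gt0// lecR.
apply/eqP; rewrite eq_le lb_le_inf ?andbT//; last by exists l.
by apply: ge_inf => //; exists l.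
Qed.

Lemma lambda1_ge0 (R : realType) (G : sgraph) (sigma : G -> G -> R[i]) :
  (0 < #|G|)%N -> magnetic_potential sigma -> 0 <= lambda1 sigma.
Proof.
move=> G0 sp; have [f [f0 fE _]] := lambda1_attained G0 sp.
have := energy_ge0 sigma f; rewrite fE pmulrn_lge0//.
by rewrite pmulr_lge0 ?mass_gt0// -(lecR 0).
Qed.

(** Comparison of ground states through test functions. More mass may only lower
    the Rayleigh quotient because the energy of the ground state is
    nonnegative. *)
Lemma lambda1_le_of_test (R : realType) (G H : sgraph)
    (sigma : G -> G -> R[i]) (tau : H -> H -> R[i]) :
  (0 < #|G|)%N -> (0 < #|H|)%N ->
  magnetic_potential sigma -> magnetic_potential tau ->
  (forall f : {ffun G -> R[i]^o}, exists2 g : {ffun H -> R[i]^o},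
     mass f <= mass g & energy tau g <= energy sigma f) ->
  lambda1 tau <= lambda1 sigma.
Proof.
move=> G0 H0 sp tp ext; have [f [f0 fE _]] := lambda1_attained G0 sp.
have [_ [_ _ tmin]] := lambda1_attained H0 tp.
have [g fg gE] := ext f.
have g0 : 0 < mass g by exact: lt_le_trans (mass_gt0 f0) fg.
rewrite -lecR -(ler_pM2r g0).
have := le_trans (tmin g) gE; rewrite fE lerMn2r /= => /le_trans; apply.
by rewrite ler_wpM2l// (lecR 0) lambda1_ge0.
Qed.

(** Test function [1]: each term of its energy is at most [2 ^+ 2]. The
    bound is crude, but it does not depend on the potential. *)
Lemma lambda1_le_card (R : realType) (G : sgraph) (sigma : G -> G -> R[i]) :
  (0 < #|G|)%N -> magnetic_potential sigma -> lambda1 sigma <= (2 * #|G|)%:R.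
Proof.
move=> G0 sp; pose one : {ffun G -> R[i]^o} := [ffun=> 1].
have [_ [_ _ /(_ one)]] := lambda1_attained G0 sp.
have -> : mass one = #|G|%:R :> R[i].
  rewrite -sum1_card natr_sum; apply: eq_big => // x _.
  by rewrite ffunE normr1 expr1n.
have Ele : energy sigma one <= (4 * #|G| * #|G|)%:R.
  rewrite mulnC -sum_nat_const natr_sum; apply: ler_sum => x _.
  rewrite mulnC -sum_nat_const natr_sum [leLHS]big_mkcond /=.
  apply: ler_sum => y _; case: ifP => [xy|_]; last exact: ler0n.
  have [n1 _] := sp _ _ xy; rewrite !ffunE mulr1 (natrX _ 2 2).
  rewrite lerXn2r ?nnegrE ?ler0n//.
  by rewrite (le_trans (ler_normB _ _))// n1 normr1.
move=> /le_trans/(_ Ele) le4; have G0' : 0 < (2 * #|G|)%:R :> R[i].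
  by rewrite ltr0n muln_gt0.
rewrite -lecR rmorph_nat -(ler_pM2r G0') -natrM.
have -> : (2 * #|G| * (2 * #|G|) = 4 * #|G| * #|G|)%N by ring.
by rewrite natrM mulrCA mulrC mulr_natr.
Qed.

(** * Graph isomorphisms *)

Lemma graph_iso_sym (G H : sgraph) : graph_iso G H -> graph_iso H G.
Proof.
move=> [phi [psi phiK psiK] phi_adj]; exists psi; first by exists phi.
by move=> x y; rewrite -phi_adj !psiK.
Qed.

Lemma pullback_potential (R : realType) (G H : sgraph) (phi : G -> H)
    (sigma : H -> H -> R[i]) :
  (forall x y, adj (phi x) (phi y) = adj x y) -> magnetic_potential sigma ->
  magnetic_potential (fun x y => sigma (phi x) (phi y)).
Proof. by move=> phi_adj sp x y xy; apply: sp; rewrite phi_adj. Qed.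

Lemma pullback_eigenvalue (R : realType) (G H : sgraph) (phi : G -> H)
    (sigma : H -> H -> R[i]) (l : R[i]) :
  bijective phi -> (forall x y, adj (phi x) (phi y) = adj x y) ->
  magnetic_eigenvalue sigma l ->
  magnetic_eigenvalue (fun x y => sigma (phi x) (phi y)) l.
Proof.
move=> phi_bij phi_adj /magnetic_eigenvalueP[f f0 fl].
have [psi phiK psiK] := phi_bij.
apply/magnetic_eigenvalueP; exists [ffun x => f (phi x)].
  apply: contra_neq f0 => /ffunP f0; apply/ffunP => x.
  by have := f0 (psi x); rewrite !ffunE psiK.
apply/ffunP => x; have /ffunP/(_ (phi x)) := fl.
rewrite !ffunE => <-; rewrite (reindex phi) /=; last exact: onW_bij.
by apply: eq_big => [y|y _]; rewrite ?phi_adj// !ffunE.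
Qed.

Lemma pullback_lambda1 (R : realType) (G H : sgraph) (phi : G -> H)
    (sigma : H -> H -> R[i]) :
  bijective phi -> (forall x y, adj (phi x) (phi y) = adj x y) ->
  lambda1 (fun x y => sigma (phi x) (phi y)) = lambda1 sigma.
Proof.
move=> phi_bij phi_adj; have [psi phiK psiK] := phi_bij.
congr inf; apply/seteqP; split => l /=; last exact: pullback_eigenvalue.
have psi_adj x y : adj (psi x) (psi y) = adj x y by rewrite -phi_adj !psiK.
move=> /(pullback_eigenvalue (Bijective psiK phiK) psi_adj).
congr (magnetic_eigenvalue _ l%:C%C).
by apply/funext => x; apply/funext => y; rewrite !psiK.
Qed.

Lemma nu_iso (R : realType) (G H : sgraph) : graph_iso G H -> nu R G = nu R H.
Proof.
suff sub (G1 H1 : sgraph) : graph_iso G1 H1 ->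
    ([set l : R | exists2 sigma : H1 -> H1 -> R[i],
        magnetic_potential sigma & l = lambda1 sigma]
     `<=` [set l : R | exists2 sigma : G1 -> G1 -> R[i],
        magnetic_potential sigma & l = lambda1 sigma])%classic.
  move=> GH; congr sup; apply/seteqP; split; apply: sub => //.
  exact: graph_iso_sym.
move=> [phi phi_bij phi_adj] l [sigma sp ->].
exists (fun x y => sigma (phi x) (phi y)); first exact: pullback_potential.
by rewrite pullback_lambda1.
Qed.

(** * Splitting an edge *)

Lemma big_option (R : Type) (idx : R) (op : Monoid.com_law idx) (T : finType)
    (P : pred (option T)) (F : option T -> R) :
  \big[op/idx]_(a | P a) F a =
    op (if P None then F None else idx)
       (\big[op/idx]_(x | P (Some x)) F (Some x)).
Proof.
have -> : index_enum (option T) = None :: map some (index_enum T).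
  by rewrite ![index_enum _]unlock [in LHS]unlock.
by rewrite big_cons big_map; case: (P None); rewrite ?Monoid.mul1m.
Qed.

(** On the edge [xy], the transport along the path through the new vertex. The
    condition covers both orientations, so the values on [(x, y)] and [(y, x)]
    are inverse to each other. *)
Definition contracted_potential (R : realType) (G : sgraph) (x y : G)
    (sigma : split_graph x y -> split_graph x y -> R[i]) (u v : G) : R[i] :=
  if (u == x) && (v == y) || (u == y) && (v == x)
  then sigma (Some u) None * sigma None (Some v)
  else sigma (Some u) (Some v).

Lemma contracted_potential_potential (R : realType) (G : sgraph) (x y : G)
    (sigma : split_graph x y -> split_graph x y -> R[i]) :
  magnetic_potential sigma -> magnetic_potential (contracted_potential sigma).
Proof.
move=> sp u v uv; rewrite /contracted_potential.
rewrite [(v == x) && _]andbC [(v == y) && _]andbC orbC.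
have [e|ne] := boolP ((u == y) && _ || _); last first.
  by apply: sp; rewrite /= uv orbC.
have uz : @adj (split_graph x y) (Some u) None.
  by rewrite /=; case/orP: e => /andP[-> _]; rewrite ?orbT.
have zv : @adj (split_graph x y) None (Some v).
  by rewrite /=; case/orP: e => /andP[_ ->]; rewrite ?orbT.
have [n1 ->] := sp _ _ uz; have [n2 ->] := sp _ _ zv.
by rewrite normrM n1 n2 mul1r invfM mulrC.
Qed.

(** The value at the new vertex is the transport of the value at [x], so that
    the difference along the edge from [x] to the new vertex vanishes. *)
Definition split_extension (R : realType) (G : sgraph) (x y : G)
    (sigma : split_graph x y -> split_graph x y -> R[i])
    (f : {ffun G -> R[i]^o}) : {ffun split_graph x y -> R[i]^o} :=
  [ffun a => if a is Some u then f u else sigma None (Some x) * f x].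

Lemma mass_split_extension (R : realType) (G : sgraph) (x y : G)
    (sigma : split_graph x y -> split_graph x y -> R[i])
    (f : {ffun G -> R[i]^o}) :
  mass f <= mass (split_extension sigma f).
Proof.
rewrite [leRHS]big_option /=.
under [X in _ <= _ + X]eq_bigr do rewrite ffunE.
by rewrite lerDr exprn_ge0.
Qed.

(** The half-edge at [x] carries no energy, the one at [y] carries that of [xy],
    and all other edges are unchanged. *)
Lemma energy_split_extension (R : realType) (G : sgraph) (x y : G)
    (sigma : split_graph x y -> split_graph x y -> R[i])
    (f : {ffun G -> R[i]^o}) :
  adj x y -> magnetic_potential sigma ->
  energy sigma (split_extension sigma f) =
    energy (contracted_potential sigma) f.
Proof.
move=> xy sp; set g := split_extension sigma f.
set tau := contracted_potential sigma.
have tp : magnetic_potential tau by exact: contracted_potential_potential.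
have yx : y != x by apply: contraTneq xy => ->; rewrite adj_irrefl.
pose e a b : R[i] := `|g a - sigma a b * g b| ^+ 2.
pose w u v : R[i] := `|f u - tau u v * f v| ^+ 2.
have xz : @adj (split_graph x y) (Some x) None by rewrite /= eqxx.
have yz : @adj (split_graph x y) (Some y) None by rewrite /= eqxx orbT.
have eC u : @adj (split_graph x y) (Some u) None ->
    e None (Some u) = e (Some u) None.
  by move=> uz; rewrite /e edge_energyC.
have ex : e (Some x) None = 0.
  by rewrite -eC// /e !ffunE subrr normr0 expr0n.
have ey : e (Some y) None = w y x.
  by rewrite /e /w !ffunE /tau /contracted_potential !eqxx orbT mulrA.
have wxy : w x y = w y x by rewrite /w edge_energyC// adj_sym.
have sumz (F : G -> R[i]) : \sum_(u | (u == x) || (u == y)) F u = F x + F y.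
  rewrite (bigD1 x) ?eqxx//= (big_pred1 y)// => u /=.
  by have [->|] := eqVneq u x; rewrite ?andbF ?andbT//= eq_sym (negPf yx).
pose old u v := adj u v && ~~ ((u == x) && (v == y) || (u == y) && (v == x)).
have -> : energy sigma g = (\sum_u \sum_(v | old u v) w u v) + w y x *+ 2.
  transitivity (\sum_a \sum_(b | @adj (split_graph x y) a b) e a b).
    by [].
  rewrite big_option /= big_option /= Monoid.mul1m sumz !eC// ex add0r ey.
  have -> : \sum_u \sum_(b | split_adj x y (Some u) b) e (Some u) b =
     \sum_u ((if (u == x) || (u == y) then e (Some u) None else 0) +
            \sum_(v | old u v) w u v).
    apply: eq_bigr => u _; rewrite big_option /=; congr (_ + _).
    apply: eq_bigr => v /andP[_ /negPf n].
    by rewrite /e /w !ffunE /tau /contracted_potential n.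
  rewrite big_split /= -big_mkcond sumz ex add0r ey mulr2n.
  by rewrite addrA addrC.
rewrite /energy !pair_big_dep /= [RHS](bigD1 (x, y))//=.
rewrite [in RHS](bigD1 (y, x)) /=; last first.
  by rewrite adj_sym xy xpair_eqE (negPf yx).
rewrite -/(w x y) -/(w y x) wxy addrA -mulr2n addrC; congr (_ + _).
apply: eq_bigl => -[u v] /=; rewrite /old !xpair_eqE.
by rewrite negb_or andbA.
Qed.

(** The edge makes both vertex sets nonempty, so [lambda1] is a genuine
    eigenvalue on both graphs. *)
Lemma nu_split (R : realType) (G : sgraph) (x y : G) :
  adj x y -> nu R (split_graph x y) <= nu R G.
Proof.
move=> xy; have G0 : (0 < #|G|)%N by apply/card_gt0P; exists x.
have H0 : (0 < #|split_graph x y|)%N by apply/card_gt0P; exists None.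
apply: ge_sup => [|_ [sigma sp ->]].
  exists (lambda1 (fun _ _ : split_graph x y => 1 : R[i])).
  exists (fun _ _ => 1) => // a b _.
  by rewrite normr1 invr1.
have tp := contracted_potential_potential sp.
apply: (@le_trans _ _ (lambda1 (contracted_potential sigma))).
  apply: lambda1_le_of_test => // f; exists (split_extension sigma f).
    exact: mass_split_extension.
  by rewrite energy_split_extension.
apply: ub_le_sup; last by exists (contracted_potential sigma).
by exists (2 * #|G|)%:R => _ [tau tau_p ->]; exact: lambda1_le_card.
Qed.

Lemma nu_edge_splitting (R : realType) (G H : sgraph) :
  edge_splitting G H -> nu R H <= nu R G.
Proof. by move=> [x [y [xy /nu_iso <-]]]; exact: nu_split. Qed.

Theorem lemma4p9 (R : realType) (G : sgraph) :
  (forall Gt : sgraph, edge_splitting G Gt -> nu R Gt <= nu R G) /\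
  (forall Gt : sgraph, subdivision G Gt -> nu R Gt <= nu R G).
Proof.
split=> [Gt|Gt]; first exact: nu_edge_splitting.
elim=> {Gt} [H /nu_iso <- //|H K _ HG HK].
exact: le_trans (nu_edge_splitting R HK) HG.
Qed.
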